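(* Let $N\ge 2$, let $Y=(y_1,\dots,y_N)$ be a tuple of $N$ distinct points in $\mathbb{R}^3$, and let $\mathbb{A}\subset\overline{\mathbb{C}}_-=\mathbb{C}_-\cup\mathbb{R}\cup\{\infty\}$. Then there exists a constant $c_1=c_1(Y)>0$ (depending only on $Y$) such that $$\mathfrak{r}_{\min}(f;\mathbb{F}_{\mathbb{A}})\ \ge\ \frac{2}{N\,\mathrm{diam}(Y)}\,\ln(|f|+1)-c_1$$ for all frequencies $f>0$ achievable over $\mathbb{F}_{\mathbb{A}}$.
   Context: Notation: $\mathbb{C}_\pm=\{z\in\mathbb{C}:\pm\mathrm{Im}\,z>0\}$; $\mathrm{diam}(Y)=\max_{j,j'}|y_j-y_{j'}|$. For $x\in\mathbb{R}^3\setminus\{0\}$ and $z\in\mathbb{C}$ put $G_z(x)=\frac{e^{\mathrm{i}z|x|}}{4\pi|x|}$. For $\alpha=(\alpha_j)_{j=1}^N\in\mathbb{C}^N$, $\Gamma_{\alpha,Y}(z)$ is the $N\times N$ matrix with diagonal entries $\alpha_j-\frac{\mathrm{i}z}{4\pi}$ and off-diagonal entries $-G_z(y_j-y_{j'})$, $j\ne j'$. For $\alpha\in(\mathbb{C}\cup\{\infty\})^N$ one sets $\det\Gamma_{\alpha,Y}(z):=\det\Gamma_{\widetilde\alpha,\widetilde Y}(z)$, where $\widetilde\alpha,\widetilde Y$ are obtained from $\alpha,Y$ by deleting the components with indices $j$ such that $\alpha_j=\infty$ (the determinant of the empty matrix is $1$). $\Sigma(\alpha,Y)\subset\mathbb{C}$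 denotes the set of zeros of $\det\Gamma_{\alpha,Y}(\cdot)$, and $\Sigma_{\mathrm{res}}(\alpha,Y):=\Sigma(\alpha,Y)\cap(\mathbb{C}_-\cup\mathbb{R})$ is the set of resonances of the point-interaction Hamiltonian $H_\alpha=-\Delta_{\alpha,Y}$. $\mathbb{F}_{\mathbb{A}}=\{H_\alpha:\alpha\in\mathbb{A}^N\}$ and $\Sigma_{\mathrm{res}}[\mathbb{F}_{\mathbb{A}}]=\bigcup_{\alpha\in\mathbb{A}^N}\Sigma_{\mathrm{res}}(\alpha,Y)$. A real number $f$ is an achievable frequency over $\mathbb{F}_{\mathbb{A}}$ if $f=\mathrm{Re}\,k$ for some $k\in\Sigma_{\mathrm{res}}[\mathbb{F}_{\mathbb{A}}]$. For an achievable $f$, $\mathfrak{r}_{\min}(f;\mathbb{F}_{\mathbb{A}}):=\inf\{\mathfrak{r}\in[0,+\infty): f-\mathrm{i}\mathfrak{r}\in\Sigma_{\mathrm{res}}[\mathbb{F}_{\mathbb{A}}]\}$. *)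

(* Defs.v *)
(* Real numbers are an arbitrary [R : realType], complex numbers are [R[i]]. *)
From HB Require Import structures.
From mathcomp Require Import all_boot all_order all_algebra.
From mathcomp Require Import all_classical all_reals all_analysis.
From mathcomp Require Export complex.

Set Implicit Arguments.
Unset Strict Implicit.
Unset Printing Implicit Defensive.

Import Order.TTheory GRing.Theory Num.Theory.
Local Open Scope classical_set_scope.
Local Open Scope ring_scope.
Local Open Scope complex_scope.

Section PointInteractions.
Variable R : realType.
Local Notation C := R[i].

(* Written out because ['i] would be parsed as the imaginary unit of an abstract
   [numClosedFieldType]. *)
Definition iu : C := 0 +i* 1.

(* The exponential on [R[i]], which the libraries lack. *)
Definition cexp (z : C) : C :=
  (expR (complex.Re z) * cos (complex.Im z)) +i*
  (expR (complex.Re z) * sin (complex.Im z)).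

(* The canonical norm of ['rV[R]_3] is the sup norm; this is the Euclidean one. *)
Definition enorm (x : 'rV[R]_3) : R := Num.sqrt (\sum_(i < 3) x 0 i ^+ 2).

Definition diam (N : nat) (Y : 'I_N -> 'rV[R]_3) : R :=
  \big[Num.max/0]_(j < N) \big[Num.max/0]_(j' < N) enorm (Y j - Y j').

(* Only used for [x != 0]. *)
Definition green (z : C) (x : 'rV[R]_3) : C :=
  cexp (iu * z * (enorm x)%:C) / (4 * pi * enorm x)%:C.

Definition Gamma (n : nat) (alpha : 'I_n -> C) (Y : 'I_n -> 'rV[R]_3) (z : C)
    : 'M[C]_n :=
  \matrix_(j, j') if j == j' then alpha j - iu * z / (4 * pi)%:C
                  else - green z (Y j - Y j').

(* [option C] is the set of complex numbers together with infinity = [None]. *)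
Definition finite_indices (N : nat) (alpha : 'I_N -> option C) : {set 'I_N} :=
  [set j | alpha j != None]%SET.

(* [enum_val] lists the indices of the finite components in increasing order;
   the default value 0 of [odflt] is never reached. *)
Definition alpha_tilde (N : nat) (alpha : 'I_N -> option C)
    (k : 'I_#|finite_indices alpha|) : C :=
  odflt 0 (alpha (enum_val k)).

Definition Y_tilde (N : nat) (alpha : 'I_N -> option C)
    (Y : 'I_N -> 'rV[R]_3) (k : 'I_#|finite_indices alpha|) : 'rV[R]_3 :=
  Y (enum_val k).

Definition det_Gamma (N : nat) (alpha : 'I_N -> option C)
    (Y : 'I_N -> 'rV[R]_3) (z : C) : C :=
  \det (Gamma (@alpha_tilde N alpha) (@Y_tilde N alpha Y) z).

Definition Sigma (N : nat) (alpha : 'I_N -> option C)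
    (Y : 'I_N -> 'rV[R]_3) : set C :=
  [set z | det_Gamma alpha Y z = 0].

Definition C_minus : set C := [set z | complex.Im z < 0].

Definition C_real : set C := [set x%:C | x in [set: R]].

Definition Sigma_res (N : nat) (alpha : 'I_N -> option C)
    (Y : 'I_N -> 'rV[R]_3) : set C :=
  Sigma alpha Y `&` (C_minus `|` C_real).

Definition Cbar_minus : set (option C) :=
  (Some @` (C_minus `|` C_real)) `|` [set None].

(* The family of Hamiltonians H_alpha, alpha in A^N, enters only through the
   resonance sets of its members, so it is represented by the parameters. *)
Definition params (N : nat) (A : set (option C)) : set ('I_N -> option C) :=
  [set alpha | forall j, A (alpha j)].

Definition Sigma_res_family (N : nat) (Y : 'I_N -> 'rV[R]_3)
    (A : set (option C)) : set C :=
  \bigcup_(alpha in @params N A) Sigma_res alpha Y.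

Definition achievable (N : nat) (Y : 'I_N -> 'rV[R]_3) (A : set (option C))
    (f : R) : Prop :=
  exists2 k, Sigma_res_family Y A k & f = complex.Re k.

(* For achievable [f] this is the infimum of a nonempty set of nonnegative
   reals, so the real-valued [inf] takes no default value. *)
Definition r_min (N : nat) (Y : 'I_N -> 'rV[R]_3) (A : set (option C))
    (f : R) : R :=
  inf [set r : R | 0 <= r /\ Sigma_res_family Y A (f -i* r)].

End PointInteractions.

(* Main.v *)
Require Import Defs.
From mathcomp Require Import all_boot all_order all_algebra.
From mathcomp Require Import all_classical all_reals all_analysis.
From mathcomp Require Import complex.
From mathcomp Require Import ring lra.

(** Write a resonance as z = f - i r with f > 0 and r >= 0. On the diagonal of
    the singular matrix Gamma(z), the imaginary part is
    Im alpha_j - f / (4 pi) <= - f / (4 pi), because Im alpha_j <= 0; so a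
    diagonal entry has modulus at least f / (4 pi). Off the diagonal, the
    entries grow only through r: |G_z(x)| = e^(r |x|) / (4 pi |x|), at most
    K e^(r D) / (4 pi), where D = diam Y and K, called [max_inv_dist], is the
    largest inverse distance of two points of Y. A singular matrix cannot be
    strictly diagonally dominant (Gershgorin, [singular_not_dominant]), hence
    f <= N K e^(r D), which is [resonance_bound].
    Since e^(r D) >= 1, it follows that f + 1 <= (N K + 1) e^(r D), and
    logarithms give r >= (ln (f + 1) - ln (N K + 1)) / D. As N >= 2, the
    coefficient 1 / D is at least 2 / (N D); the constant K depends on all of
    Y and not on the points that remain when the infinite components are
    deleted, so c1 depends on Y alone. *)

Import Order.TTheory GRing.Theory Num.Theory.
Local Open Scope classical_set_scope.
Local Open Scope ring_scope.

(** In a left kernel vector v, take a coordinate v_j of maximal modulus: the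
    j-th equation expresses v_j A_jj through the terms v_i A_ij, where
    |v_i| <= |v_j|. *)
Lemma singular_not_dominant (F : numFieldType) (n : nat) (A : 'M[F]_n) :
  \det A = 0 -> exists j, `|A j j| <= \sum_(i | i != j) `|A i j|.
Proof.
move=> /eqP/det0P[v /rV0Pn[i0 vi0] vA0].
have [j _ jmax] := @real_arg_maxP F _ i0 xpredT (fun i => `|v 0 i|) isT
  (fun i _ => normr_real _).
have jle i : `|v 0 i| <= `|v 0 j| by exact: jmax.
have vj_gt0 : 0 < `|v 0 j|.
  by rewrite (lt_le_trans _ (jle i0)) ?normr_gt0.
exists j; rewrite -(ler_pM2l vj_gt0) mulr_sumr -normrM.
have /rowP/(_ j) := vA0; rewrite !mxE (bigD1 j) //= => /eqP.
rewrite addr_eq0 => /eqP ->; rewrite normrN.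
apply: le_trans (ler_norm_sum _ _ _) _; apply: ler_sum => i _.
by rewrite normrM ler_wpM2r ?normr_ge0 ?jle.
Qed.

Section ResonanceBound.
Set Implicit Arguments.
Unset Strict Implicit.
Variable R : realType.
Local Open Scope complex_scope.

Lemma normc_ge_Im (z : R[i]) : `|complex.Im z|%:C <= `|z|.
Proof.
by rewrite normc_def lecR -sqrtr_sqr ler_wsqrtr // lerDr sqr_ge0.
Qed.

Lemma norm_cexp (z : R[i]) : `|cexp z| = (expR (complex.Re z))%:C.
Proof.
rewrite normc_def /cexp /=; congr (_%:C).
by rewrite !exprMn -mulrDr cos2Dsin2 mulr1 sqrtr_sqr ger0_norm ?expR_ge0.
Qed.

Lemma enorm_ge0 (x : 'rV[R]_3) : 0 <= enorm x.
Proof. exact: sqrtr_ge0. Qed.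

Lemma enorm_gt0 (x : 'rV[R]_3) : x != 0 -> 0 < enorm x.
Proof.
move=> /rV0Pn[i xi]; rewrite sqrtr_gt0 (bigD1 i) //=.
by rewrite ltr_wpDr ?exprn_even_gt0 // sumr_ge0 // => k _; rewrite sqr_ge0.
Qed.

Lemma norm_green (z : R[i]) (x : 'rV[R]_3) :
  `|green z x| =
  (expR (- complex.Im z * enorm x) * (enorm x)^-1 / (4 * pi))%:C.
Proof.
have d_ge0 : 0 <= 4 * pi * enorm x :> R.
  by rewrite !mulr_ge0 ?pi_ge0 ?enorm_ge0.
rewrite /green normrM normfV norm_cexp ger0_norm ?ler0c //.
rewrite -fmorphV -rmorphM; congr (_%:C).
rewrite invfM mulrA mulrAC; congr (expR _ * _ / _).
by case: z => a b; rewrite /iu /=; ring.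
Qed.

Variables (N : nat) (Y : 'I_N -> 'rV[R]_3).

Lemma enorm_le_diam (i j : 'I_N) : enorm (Y i - Y j) <= diam Y.
Proof. by apply: (bigmax_sup i) => //; exact: le_bigmax. Qed.

Lemma diam_gt0 : (2 <= N)%N -> injective Y -> 0 < diam Y.
Proof.
move=> N2 Yinj; pose i := Ordinal (ltnW N2); pose j := Ordinal N2.
apply: lt_le_trans (enorm_le_diam i j); apply: enorm_gt0.
by rewrite subr_eq0 (inj_eq Yinj).
Qed.

(** The terms with i = j contribute 0^-1 = 0, so they do not affect the
    maximum. *)
Definition max_inv_dist : R :=
  \big[Num.max/0]_(i < N) \big[Num.max/0]_(j < N) (enorm (Y i - Y j))^-1.

Lemma inv_dist_le (i j : 'I_N) : (enorm (Y i - Y j))^-1 <= max_inv_dist.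
Proof. by apply: (bigmax_sup i) => //; exact: le_bigmax. Qed.

Lemma max_inv_dist_ge0 : 0 <= max_inv_dist.
Proof. exact: bigmax_ge_id. Qed.

Lemma norm_green_le (f r : R) (i j : 'I_N) : 0 <= r ->
  `|green (f -i* r) (Y i - Y j)| <=
  (expR (r * diam Y) * max_inv_dist / (4 * pi))%:C.
Proof.
move=> r0; rewrite norm_green lecR /= opprK.
rewrite ler_wpM2r ?invr_ge0 ?mulr_ge0 ?pi_ge0 //.
apply: ler_pM; rewrite ?expR_ge0 ?invr_ge0 ?enorm_ge0 ?inv_dist_le //.
by rewrite ler_expR ler_wpM2l ?enorm_le_diam.
Qed.

(** Since i (f - i r) = r + i f, the damping r enters only the real part of a
    diagonal entry, while Im a <= 0 and f > 0 push the imaginary part in the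
    same direction and cannot cancel. *)
Lemma norm_diag_ge (a : R[i]) (f r : R) : complex.Im a <= 0 -> 0 < f ->
  (f / (4 * pi))%:C <= `|a - iu R * (f -i* r) / (4 * pi)%:C|.
Proof.
move=> a0 f0; apply: le_trans (normc_ge_Im _).
have p0 : 0 < f / (4 * pi) by rewrite divr_gt0 ?mulr_gt0 ?pi_gt0.
rewrite lecR; rewrite -fmorphV.
case: a a0 => x y /= y0.
have -> : y - ((0 * f - 1 * - r) * 0 + (0 * - r + 1 * f) * (4 * pi)^-1) =
  y - f / (4 * pi) by ring.
by rewrite ler0_norm; lra.
Qed.

Lemma Cbar_minus_Im (a : R[i]) : @Cbar_minus R (Some a) -> complex.Im a <= 0.
Proof.
by case=> [[b bP [<-]]|//]; case: bP => [/ltW|[x _ <-]].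
Qed.

Lemma resonance_bound (alpha : 'I_N -> option R[i]) (f r : R) :
  0 < f -> 0 <= r -> (forall j, @Cbar_minus R (alpha j)) ->
  Sigma alpha Y (f -i* r) -> f <= N%:R * max_inv_dist * expR (r * diam Y).
Proof.
move=> f0 r0 alphaP /singular_not_dominant[j].
set n := #|finite_indices alpha|; set B := expR (r * diam Y) * max_inv_dist.
have p0 : 0 < 4 * pi :> R by rewrite mulr_gt0 ?pi_gt0.
have B0 : 0 <= B / (4 * pi).
  by rewrite divr_ge0 ?(ltW p0) // mulr_ge0 ?expR_ge0 ?max_inv_dist_ge0.
have n_le_N : (n <= N)%N by rewrite -[leqRHS]card_ord max_card.
rewrite mxE eqxx => diag_le.
have aP : complex.Im (alpha_tilde j) <= 0.
  apply: Cbar_minus_Im; rewrite /alpha_tilde.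
  by have := alphaP (enum_val j); have := enum_valP j; rewrite inE; case: (alpha _).
have := le_trans (norm_diag_ge r aP f0) diag_le.
have offdiag : \sum_(i < n | i != j)
    `|Gamma (@alpha_tilde R N alpha) (@Y_tilde R N alpha Y) (f -i* r) i j| <=
    (N%:R * (B / (4 * pi)))%:C.
  apply: le_trans (_ : _ <= \sum_(i < n) (B / (4 * pi))%:C) _.
    rewrite [leRHS](bigID (fun i => i != j)) /= -[leLHS]addr0 lerD //.
      apply: ler_sum => i /negPf ij.
      by rewrite mxE ij normrN norm_green_le.
    by apply: sumr_ge0 => i _; rewrite ler0c.
  rewrite sumr_const card_ord -rmorphMn lecR /= -[leLHS]mulr_natl.
  by rewrite ler_wpM2r // ler_nat.
move=> /le_trans /(_ offdiag); rewrite lecR mulrA ler_pM2r ?invr_gt0 //.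
by rewrite /B [expR _ * _]mulrC mulrA.
Qed.

End ResonanceBound.

Theorem theorem5p1 (R : realType) (N : nat) (hN : (2 <= N)%N)
    (Y : 'I_N -> 'rV[R]_3) (hY : injective Y) :
  exists2 c1 : R, 0 < c1 &
    forall A : set (option R[i]), A `<=` @Cbar_minus R ->
    forall f : R, 0 < f -> achievable Y A f ->
      r_min Y A f >= 2 / (N%:R * diam Y) * ln (`|f| + 1) - c1.
Proof.
have D0 := diam_gt0 hN hY; set D := diam Y in D0 *.
have M0 : 0 <= N%:R * max_inv_dist Y by rewrite mulr_ge0 ?max_inv_dist_ge0.
set M := N%:R * max_inv_dist Y in M0.
have L0 : 0 <= ln (M + 1) by rewrite ln_ge0 // lerDr.
(* The last + 1 only serves to make the constant strictly positive. *)
exists (ln (M + 1) / D + 1); first by rewrite ltr_wpDl // divr_ge0 ?(ltW D0).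
(* Achievability makes the set defining the infimum nonempty; without it the
   lower bound on its elements would say nothing about [inf]. *)
move=> A hA f f0 [k kA fE]; apply: lb_le_inf.
  exists (- complex.Im k); split.
    have [alpha _ [_ [/ltW|[x _ <-]]]] := kA; last by rewrite /= oppr0.
    by rewrite oppr_ge0.
  by rewrite opprK fE; case: k kA {fE}.
move=> r [r0 [alpha alphaA [Sk _]]].
have f_le := resonance_bound f0 r0 (fun j => hA _ (alphaA j)) Sk.
rewrite -/M -/D in f_le.
have f1_le : ln (f + 1) <= ln (M + 1) + r * D.
  rewrite -[r * D]expRK -lnM ?posrE ?expR_gt0 ?ltr_wpDl //.
  rewrite ler_ln ?posrE ?mulr_gt0 ?expR_gt0 ?ltr_wpDl ?(ltW f0) //.
  rewrite mulrDl mul1r lerD // -expR0 ler_expR.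
  by rewrite mulr_ge0 ?(ltW D0).
have coef_le : 2 / (N%:R * D) <= D^-1.
  have N0 : 0 < N%:R :> R by rewrite ltr0n (ltnW hN).
  rewrite invfM mulrA ger_pMl ?invr_gt0 //.
  by rewrite ler_pdivrMr // mul1r ler_nat.
rewrite ger0_norm ?(ltW f0) // lerBlDr.
apply: le_trans (_ : D^-1 * ln (f + 1) <= _).
  by rewrite ler_wpM2r // ln_ge0 // lerDr (ltW f0).
rewrite mulrC ler_pdivrMr //.
rewrite [leRHS]mulrDl mulrDl divfK ?(gt_eqF D0) // mul1r.
by apply: le_trans f1_le _; lra.
Qed.
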